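(* Let $\Phi$ be a finite set of closed formulas of the $\epsilon$-arithmetic language, and let $S$ and $T$ be two substitutions providing substituents for all categories of the $\epsilon$-terms occurring in $\Phi$. If $T$ is progressive on $S$, then either (1) $o(T)<o(S)$, or (2) every closed $\epsilon$-term occurring in the formulas of $\Phi$ receives the same value under $S$ and under $T$.
   Context: Language of $\epsilon$-arithmetic: terms are built from variables, $0$, the unary function symbols $'$ (successor) and $d$ (predecessor), the binary symbols $+,\times$, and $\epsilon$-terms $\epsilon_x A$ where $A$ is a formula; formulas are built from equations $a=b$ with $\to$ and $\sim$ (negation). For a closed $\epsilon$-term $\epsilon_x A$, its category is the term obtained by replacing each of its immediate subterms in which $x$ does not occur free by a fresh variable; a category with $k$ free variables is a $k$-ary pattern. A substitution relative to $\Phi$ assigns to each category (with $k$ free variables) of the $\epsilon$-terms of $\Phi$ a function $\mathbb{N}^k\to\mathbb{N}$ (its substituent). Under a substitution, every closed term gets a numerical value computed recursively: $0,',d,+,\times$ have their usual meaning (with $d(0)=0$, $d(a')=a$), and a closed $\epsilon$-term gets the value of the substituent of its category applied to the values of the subterms that were replaced by variables. Order of a substitution: fix an enumeration $a_0,\dots,a_k$ of the closed $\epsilon$-terms occurring in $\Phi$ such that each subterm precedes any term containing it; set $o(S)=\sum_{i=0}^{k}2^{k-i}f(i)$, where $f(i)=1$ if $S$ gives $a_i$ the value $0$ and $f(i)=0$ otherwise. $T$ is progressive on $S$ if, whenever a substituent of $S$ takes a nonzero value at some argument tuple, the substituent of $T$ for the same category takes the same value at that argument tuple. *)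

(* Defs.v *)
From HB Require Import structures.
From mathcomp Require Import all_boot finmap.

Set Implicit Arguments.
Unset Strict Implicit.
Unset Printing Implicit Defensive.

Local Open Scope fset_scope.

Inductive term : Type :=
| Var of nat
| Zero
| Succ of term
| Pred of term
| Add of term & term
| Mul of term & term
| Eps of nat & formula
with formula : Type :=
| Eqn of term & term
| Imp of formula & formula
| Neg of formula.

Scheme term_formula_ind := Induction for term Sort Prop
with formula_term_ind := Induction for formula Sort Prop.
Combined Scheme expr_ind from term_formula_ind, formula_term_ind.

Fixpoint encode_term (t : term) : GenTree.tree nat :=
  match t with
  | Var n => GenTree.Leaf n
  | Zero => GenTree.Node 0 [::]
  | Succ a => GenTree.Node 1 [:: encode_term a]
  | Pred a => GenTree.Node 2 [:: encode_term a]
  | Add a b => GenTree.Node 3 [:: encode_term a; encode_term b]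
  | Mul a b => GenTree.Node 4 [:: encode_term a; encode_term b]
  | Eps n A => GenTree.Node 5 [:: GenTree.Leaf n; encode_formula A]
  end
with encode_formula (A : formula) : GenTree.tree nat :=
  match A with
  | Eqn a b => GenTree.Node 0 [:: encode_term a; encode_term b]
  | Imp B C => GenTree.Node 1 [:: encode_formula B; encode_formula C]
  | Neg B => GenTree.Node 2 [:: encode_formula B]
  end.

Fixpoint decode_term (u : GenTree.tree nat) : option term :=
  match u with
  | GenTree.Leaf n => Some (Var n)
  | GenTree.Node 0 [::] => Some Zero
  | GenTree.Node 1 [:: u1] => omap Succ (decode_term u1)
  | GenTree.Node 2 [:: u1] => omap Pred (decode_term u1)
  | GenTree.Node 3 [:: u1; u2] =>
      obind (fun a => omap (Add a) (decode_term u2)) (decode_term u1)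
  | GenTree.Node 4 [:: u1; u2] =>
      obind (fun a => omap (Mul a) (decode_term u2)) (decode_term u1)
  | GenTree.Node 5 [:: GenTree.Leaf n; u2] => omap (Eps n) (decode_formula u2)
  | _ => None
  end
with decode_formula (u : GenTree.tree nat) : option formula :=
  match u with
  | GenTree.Node 0 [:: u1; u2] =>
      obind (fun a => omap (Eqn a) (decode_term u2)) (decode_term u1)
  | GenTree.Node 1 [:: u1; u2] =>
      obind (fun B => omap (Imp B) (decode_formula u2)) (decode_formula u1)
  | GenTree.Node 2 [:: u1] => omap Neg (decode_formula u1)
  | _ => None
  end.

Lemma encodeK :
  (forall t, decode_term (encode_term t) = Some t) /\
  (forall A, decode_formula (encode_formula A) = Some A).
Proof.
by apply: expr_ind => //= [a ->|a ->|a -> b ->|a -> b ->|n A ->|a -> b ->|A -> B ->|A ->].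
Qed.

HB.instance Definition _ := Countable.copy term (pcan_type encodeK.1).
HB.instance Definition _ := Countable.copy formula (pcan_type encodeK.2).

Fixpoint fv (t : term) : {fset nat} :=
  match t with
  | Var n => [fset n]
  | Zero => fset0
  | Succ a | Pred a => fv a
  | Add a b | Mul a b => fv a `|` fv b
  | Eps x A => fv_formula A `\ x
  end
with fv_formula (A : formula) : {fset nat} :=
  match A with
  | Eqn a b => fv a `|` fv b
  | Imp B C => fv_formula B `|` fv_formula C
  | Neg B => fv_formula B
  end.

Definition closed_term (t : term) : bool := fv t == fset0.
Definition closed_formula (A : formula) : bool := fv_formula A == fset0.

(* Reflexive, and descending into the formulas under an epsilon. *)
Fixpoint subterms (t : term) : {fset term} :=
  t |` match t with
       | Var _ | Zero => fset0
       | Succ a | Pred a => subterms a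
       | Add a b | Mul a b => subterms a `|` subterms b
       | Eps _ A => subterms_formula A
       end
with subterms_formula (A : formula) : {fset term} :=
  match A with
  | Eqn a b => subterms a `|` subterms b
  | Imp B C => subterms_formula B `|` subterms_formula C
  | Neg B => subterms_formula B
  end.

Definition is_eps (t : term) : bool := if t is Eps _ _ then true else false.

Definition closed_eps (Phi : {fset formula}) : {fset term} :=
  [fset e in \bigcup_(A <- Phi) subterms_formula A | is_eps e && closed_term e].

(* The sides of the equations of A, read from left to right and one entry per
   occurrence: they are the immediate subterms of [Eps x A], i.e. its proper
   subterms that do not lie inside another proper subterm. *)
Fixpoint sides (A : formula) : seq term :=
  match A with
  | Eqn a b => [:: a; b]
  | Imp B C => sides B ++ sides C
  | Neg B => sides B
  end.

Definition replaced (x : nat) (A : formula) : seq term :=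
  [seq a <- sides A | x \notin fv a].

(* Strictly above every variable, free or bound, of the expression. *)
Fixpoint bound (t : term) : nat :=
  match t with
  | Var n => n.+1
  | Zero => 0
  | Succ a | Pred a => bound a
  | Add a b | Mul a b => maxn (bound a) (bound b)
  | Eps x A => maxn x.+1 (bound_formula A)
  end
with bound_formula (A : formula) : nat :=
  match A with
  | Eqn a b => maxn (bound a) (bound b)
  | Imp B C => maxn (bound_formula B) (bound_formula C)
  | Neg B => bound_formula B
  end.

(* Depends only on the part of [Eps x A] that is not replaced, so that epsilon
   terms differing only in the replaced subterms get the same category. *)
Definition fresh (x : nat) (A : formula) : nat :=
  maxn x.+1 (\max_(a <- sides A | x \in fv a) bound a).

Definition abstract_term (x n : nat) (a : term) : term :=
  if x \in fv a then a else Var n.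

(* Replaces the entries of [replaced x A] by Var n, Var n.+1, etc. *)
Fixpoint abstract_formula (x n : nat) (A : formula) : formula :=
  match A with
  | Eqn a b => Eqn (abstract_term x n a)
                   (abstract_term x (n + (x \notin fv a)) b)
  | Imp B C => Imp (abstract_formula x n B)
                   (abstract_formula x (n + size (replaced x B)) C)
  | Neg B => Neg (abstract_formula x n B)
  end.

Definition category (e : term) : term :=
  if e is Eps x A then Eps x (abstract_formula x (fresh x A) A) else e.

Definition arity (c : term) : nat := #|` fv c|.

Definition categories (Phi : {fset formula}) : {fset term} :=
  [fset category e | e in closed_eps Phi].

Definition substitution (Phi : {fset formula}) : Type :=
  forall c : categories Phi, (arity (val c)).-tuple nat -> nat.

Definition substituent_value (Phi : {fset formula}) (S : substitution Phi)
    (c : term) (vs : seq nat) : nat :=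
  if insub c is Some c' then S c' [tuple nth 0 vs i | i < arity (val c')] else 0.

(* The clause for Var, and the value 0 given by [substituent_value] to a
   category outside [categories Phi], are never reached from a closed term all
   of whose closed epsilon subterms occur in Phi.  The number of arguments is
   then the arity ([size_replaced]), and the arguments are the values of the
   replaced subterms ([arg_valuesE]). *)
Fixpoint value (Phi : {fset formula}) (S : substitution Phi) (t : term) : nat :=
  match t with
  | Var _ => 0
  | Zero => 0
  | Succ a => (value S a).+1
  | Pred a => (value S a).-1
  | Add a b => value S a + value S b
  | Mul a b => value S a * value S b
  | Eps x A => substituent_value S (category t) (arg_values S x A)
  end
with arg_values (Phi : {fset formula}) (S : substitution Phi) (x : nat)
    (A : formula) : seq nat :=
  match A with
  | Eqn a b => (if x \in fv a then [::] else [:: value S a]) ++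
               (if x \in fv b then [::] else [:: value S b])
  | Imp B C => arg_values S x B ++ arg_values S x C
  | Neg B => arg_values S x B
  end.

Lemma arg_valuesE (Phi : {fset formula}) (S : substitution Phi) x A :
  arg_values S x A = [seq value S a | a <- replaced x A].
Proof.
rewrite /replaced; elim: A => [a b|B IB C IC|B IB] //=.
  by case: (x \in fv a); case: (x \in fv b).
by rewrite filter_cat map_cat IB IC.
Qed.

Lemma fv_abstract x n A : fv_formula A `<=` [fset x] -> x < n ->
  fv_formula (abstract_formula x n A) `\ x =i iota n (size (replaced x A)).
Proof.
have fvt m a y : fv a `<=` [fset x] -> x < m ->
    (y \in fv (abstract_term x m a) `\ x) = (x \notin fv a) && (y == m).
  move=> sa xm; rewrite /abstract_term; case: ifP => xa /=; rewrite !inE.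
    by case: eqP => //= ny; apply/negP => /(fsubsetP sa); rewrite inE => /eqP.
  by case: (y =P m) => [->|]; rewrite ?andbF // gtn_eqF.
rewrite /replaced; elim: A n => [a b|B IB C IC|B IB] n //=.
- rewrite fsubUset => /andP[sa sb] xn y.
  rewrite fsetDUl in_fsetU !fvt ?ltn_addr //.
  by case: (x \in fv a); case: (x \in fv b); rewrite /= ?addn0 ?addn1 ?inE ?orbF.
- rewrite fsubUset => /andP[sB sC] xn y.
  rewrite fsetDUl in_fsetU IB // IC ?ltn_addr // filter_cat size_cat.
  by rewrite iotaD mem_cat.
- exact: IB.
Qed.

Lemma size_replaced x A :
  closed_term (Eps x A) -> size (replaced x A) = arity (category (Eps x A)).
Proof.
rewrite /closed_term /= fsetD_eq0 => sA; rewrite /arity /=.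
rewrite -[LHS](size_iota (fresh x A)) -(undup_id (iota_uniq _ _)).
rewrite -card_fseq; congr #|` _|; apply/fsetP => y; rewrite in_fset.
by rewrite -fv_abstract // /fresh leq_maxl.
Qed.

Definition progressive (Phi : {fset formula}) (T S : substitution Phi) : Prop :=
  forall (c : categories Phi) (v : (arity (val c)).-tuple nat),
    S c v != 0 -> T c v = S c v.

Definition enumeration (Phi : {fset formula}) (es : seq term) : Prop :=
  [/\ uniq es, es =i closed_eps Phi &
      forall a b, a \in es -> b \in es -> a \in subterms b -> a != b ->
        index a es < index b es].

Definition subst_order (Phi : {fset formula}) (es : seq term)
    (S : substitution Phi) : nat :=
  \sum_(i < size es) 2 ^ ((size es).-1 - i) * (value S (nth Zero es i) == 0).

(* Main.v *)
Require Import Defs.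
From HB Require Import structures.
From mathcomp Require Import all_boot finmap.
From mathcomp Require Import zify.

Set Implicit Arguments.
Unset Strict Implicit.
Unset Printing Implicit Defensive.

Local Open Scope fset_scope.

(** Take the first epsilon term [e] of the enumeration on which [S] and [T]
    disagree.  The replaced subterms of [e] are closed, and their closed epsilon
    subterms precede [e], so both substitutions evaluate the substituent of the
    category of [e] at the same tuple.  By progressiveness the value under [S]
    must then be 0 and the value under [T] nonzero; as the order reads the zeros
    as binary digits, most significant first, [T] has the smaller order. *)

(** A measure whose only purpose is to show that [Eps x A] is not among the subterms of its own body
    [A]. *)
Fixpoint term_size (t : term) : nat :=
  match t with
  | Var _ | Zero => 1
  | Succ a | Pred a => (term_size a).+1
  | Add a b | Mul a b => (term_size a + term_size b).+1
  | Eps _ A => (formula_size A).+1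
  end
with formula_size (A : formula) : nat :=
  match A with
  | Eqn a b => (term_size a + term_size b).+1
  | Imp B C => (formula_size B + formula_size C).+1
  | Neg B => (formula_size B).+1
  end.

Lemma subterms_size s :
  (forall t, s \in subterms t -> term_size s <= term_size t) /\
  (forall A, s \in subterms_formula A -> term_size s <= formula_size A).
Proof.
apply: expr_ind => [n||a IH|a IH|a IHa b IHb|a IHa b IHb|n A IH
  |a IHa b IHb|A IHA B IHB|A IH] /=;
  rewrite ?in_fset1U ?in_fsetU ?in_fset0 ?orbF; try by move/eqP->.
all: try by case/orP => [/eqP->|/IH] //; lia.
all: try by case/or3P => [/eqP->|/IHa|/IHb] //; lia.
- by case/orP => [/IHa|/IHb]; lia.
- by case/orP => [/IHA|/IHB]; lia.
- by move/IH; lia.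
Qed.

Lemma subterms_refl t : t \in subterms t.
Proof. by case: t => *; rewrite /= in_fset1U eqxx. Qed.

Lemma subterms_trans s t : s \in subterms t ->
  (forall u, t \in subterms u -> s \in subterms u) /\
  (forall A, t \in subterms_formula A -> s \in subterms_formula A).
Proof.
move=> st; apply: expr_ind => [n||a IH|a IH|a IHa b IHb|a IHa b IHb|n A IH
  |a IHa b IHb|A IHA B IHB|A IH] /=; rewrite ?in_fset1U ?in_fsetU ?in_fset0 ?orbF.
(* In the seven term cases [t] may be the whole term; the goal is then [st] itself. *)
1-7: case: eqP => [tE _|_] /=; first by
  move: st; rewrite tE /= in_fset1U ?in_fsetU ?in_fset0 ?orbF.
all: try by [].
all: try by move/IH->; rewrite ?orbT.
all: try by case/orP => [/IHa->|/IHb->]; rewrite ?orbT.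
by case/orP => [/IHA->|/IHB->]; rewrite ?orbT.
Qed.

Lemma sides_subterms A a : a \in sides A -> a \in subterms_formula A.
Proof.
elim: A => [b c|B IB C IC|B IB] //=.
  by rewrite !inE => /orP[]/eqP->; rewrite subterms_refl ?orbT.
by rewrite mem_cat in_fsetU => /orP[/IB->|/IC->]; rewrite ?orbT.
Qed.

Lemma fv_sides A a : a \in sides A -> fv a `<=` fv_formula A.
Proof.
elim: A => [b c|B IB C IC|B IB] //=.
  by rewrite !inE => /orP[]/eqP->; rewrite ?fsubsetUl ?fsubsetUr.
rewrite mem_cat => /orP[/IB|/IC] h; apply: (fsubset_trans h);
  by rewrite ?fsubsetUl ?fsubsetUr.
Qed.

(** A variable free in a side of [A] is free in [A], hence equal to [x], which the filter in
    [replaced] excludes. *)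
Lemma closed_replaced x A a :
  closed_term (Eps x A) -> a \in replaced x A -> closed_term a.
Proof.
rewrite /closed_term /= fsetD_eq0 mem_filter => sA /andP[xa /fv_sides aA].
rewrite -fsubset0; apply/fsubsetP => y ya.
have /fsubsetP/(_ y ya) := fsubset_trans aA sA.
by rewrite inE => /eqP yx; rewrite -yx ya in xa.
Qed.

(** The induction stops at the outermost epsilon terms, where the hypothesis applies directly. No
    binder is crossed before that, so every term reached is closed. *)
Lemma eq_value (Phi : {fset formula}) (S T : substitution Phi) t :
  closed_term t ->
  (forall e, e \in subterms t -> is_eps e -> closed_term e ->
     value S e = value T e) ->
  value S t = value T t.
Proof.
rewrite /closed_term; elim: t => [n||a IH|a IH|a IHa b IHb|a IHa b IHb|x A] //=.
- by move=> ca h; rewrite IH // => e ea; apply: h; rewrite in_fset1U ea orbT.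
- by move=> ca h; rewrite IH // => e ea; apply: h; rewrite in_fset1U ea orbT.
- rewrite fsetU_eq0 => /andP[ca cb] h.
  by rewrite IHa ?IHb // => e ea; apply: h; rewrite !inE ea ?orbT.
- rewrite fsetU_eq0 => /andP[ca cb] h.
  by rewrite IHa ?IHb // => e ea; apply: h; rewrite !inE ea ?orbT.
- by move=> cA h; apply: (h (Eps x A)); rewrite ?in_fset1U ?eqxx.
Qed.

Lemma progressive_substituent_value (Phi : {fset formula})
    (S T : substitution Phi) c vs :
  progressive T S -> substituent_value S c vs != 0 ->
  substituent_value T c vs = substituent_value S c vs.
(* Outside [categories Phi] both sides are the default 0. *)
Proof. by move=> TS; rewrite /substituent_value; case: insub => // c'; apply: TS. Qed.

(** Agreement is assumed only inside the body [A], not at [Eps x A], so the lemma can be applied at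
    a first disagreement. *)
Lemma progressive_value (Phi : {fset formula}) (S T : substitution Phi) x A :
  progressive T S -> closed_term (Eps x A) ->
  (forall e, e \in subterms_formula A -> is_eps e -> closed_term e ->
     value S e = value T e) ->
  value S (Eps x A) != 0 -> value T (Eps x A) = value S (Eps x A).
Proof.
move=> TS cl h; rewrite /= !arg_valuesE.
have -> : [seq value T a | a <- replaced x A] = [seq value S a | a <- replaced x A].
  apply/eq_in_map => a aA; apply/esym/eq_value; first exact: closed_replaced aA.
  move=> e ea; apply: h; apply: (subterms_trans ea).2; apply: sides_subterms.
  by move: aA; rewrite mem_filter => /andP[].
exact: progressive_substituent_value.
Qed.

Lemma closed_eps_subterm (Phi : {fset formula}) e s :
  e \in closed_eps Phi -> s \in subterms e -> is_eps s -> closed_term s ->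
  s \in closed_eps Phi.
Proof.
rewrite !inE /= => /andP[/bigfcupP[A AP eA] _] se es cs.
rewrite es cs !andbT; apply/bigfcupP; exists A => //.
exact: (subterms_trans se).2 eA.
Qed.

(** Splits off the most significant digit, leaving a sum of the same shape in the shifted digits,
    ready for induction on [n]. *)
Lemma binary_recl n (f : nat -> bool) :
  (\sum_(j < n.+1) 2 ^ (n - j) * f j =
   2 ^ n * f 0 + \sum_(j < n) 2 ^ (n.-1 - j) * f j.+1)%N.
Proof.
rewrite big_ord_recl subn0; congr (_ + _)%N; apply: eq_bigr => j _.
by rewrite lift0; congr (2 ^ _ * _)%N; lia.
Qed.

Lemma binary_bound n (f : nat -> bool) : \sum_(j < n) 2 ^ (n.-1 - j) * f j < 2 ^ n.
Proof.
elim: n f => [|n IH] f; first by rewrite big_ord0.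
rewrite binary_recl expnS; have := IH (fun j => f j.+1).
by case: (f 0); lia.
Qed.

Lemma binary_lt n (f g : nat -> bool) i : i < n ->
  (forall j, j < i -> f j = g j) -> f i = false -> g i = true ->
  \sum_(j < n) 2 ^ (n.-1 - j) * f j < \sum_(j < n) 2 ^ (n.-1 - j) * g j.
Proof.
elim: n f g i => // n IH f g [_ _ f0 g0|i ilt eqfg fi gi]; rewrite !binary_recl.
  (* At the first differing digit [g] gains [2 ^ n], more than all remaining digits of [f]
     together. *)
  by have := binary_bound n (fun j => f j.+1); rewrite f0 g0; lia.
rewrite (eqfg 0) // ltn_add2l.
by apply: (IH (fun j => f j.+1) (fun j => g j.+1) i) => // j ji; apply: eqfg.
Qed.

Theorem theorem8 (Phi : {fset formula})
    (Phi_closed : forall A : formula, A \in Phi -> closed_formula A)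
    (es : seq term) (es_enum : enumeration Phi es)
    (S T : substitution Phi) (T_progressive : progressive T S) :
  (subst_order es T < subst_order es S)%N \/
  (forall e : term, e \in closed_eps Phi -> value S e = value T e).
Proof.
case: es_enum => es_uniq esE es_sub.
pose differ e := value S e != value T e.
case: (boolP (has differ es)) => [has_diff|/hasPn same]; last first.
  by right=> e; rewrite -esE => /same; rewrite negbK => /eqP.
left; set i := find differ es.
have ilt : i < size es by rewrite -has_find.
set e := nth Zero es i.
have e_es : e \in es := mem_nth Zero ilt.
have e_diff : value S e != value T e by apply: (nth_find Zero has_diff).
have before j : j < i -> value S (nth Zero es j) = value T (nth Zero es j).
  by move/(before_find Zero)/negbFE/eqP.
have e_closed : e \in closed_eps Phi by rewrite -esE.
have prog : value S e != 0 -> value T e = value S e.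
  have : is_eps e && closed_term e by move: e_closed; rewrite !inE => /andP[].
  case E : e => [||||||x A] //= cl; rewrite E in e_es e_closed.
  apply: progressive_value => // s sA s_eps s_cl.
  have s_sub : s \in subterms (Eps x A) by rewrite /= in_fset1U sA orbT.
  have s_es : s \in es by rewrite esE;
    exact: closed_eps_subterm e_closed s_sub s_eps s_cl.
  have s_neq : s != Eps x A.
    by apply/eqP => sE; have := (subterms_size s).2 A sA; rewrite sE /= ltnn.
  (* The enumeration places [s] strictly before [e], whose index is [i], so minimality of [i] gives
     agreement at [s]. *)
  have := es_sub _ _ s_es e_es s_sub s_neq.
  rewrite -E index_uniq // => /before; by rewrite nth_index.
have Se : value S e = 0.
  by apply/eqP; apply: contraNT e_diff => /prog ->.
apply: (@binary_lt _ (fun j => value T (nth Zero es j) == 0)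
                     (fun j => value S (nth Zero es j) == 0) i) => //.
- by move=> j ji; rewrite before.
(* Writing 0 as [value S e] turns the goal into [e_diff]. *)
- by apply/negbTE; rewrite -/e eq_sym -Se.
- by rewrite -/e Se.
Qed.
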